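(* There exists a polynomial time algorithm that, given an integer $n \geq 0$ in unary, produces a finite pattern $p$ with $g^{-n}(p) \neq \emptyset$ and $g^{-(n+1)}(p) = \emptyset$, where $g$ is the Game of Life cellular automaton.
   Context: The Game of Life is the map $g : \{0,1\}^{\mathbb{Z}^2} \to \{0,1\}^{\mathbb{Z}^2}$ defined as follows. Let $K = \{-1,0,1\}^2 \setminus \{(0,0)\}$. For $x \in \{0,1\}^{\mathbb{Z}^2}$ and $\vec v \in \mathbb{Z}^2$, put $s = \sum_{\vec u \in K} x_{\vec v + \vec u}$. Then $g(x)_{\vec v} = 1$ if and only if ($x_{\vec v} = 0$ and $s = 3$) or ($x_{\vec v} = 1$ and $s \in \{2,3\}$). A finite pattern is a function $p : D \to \{0,1\}$ with $D \subset \mathbb{Z}^2$ finite. For a finite pattern $p$ with domain $D$ and $n \ge 0$, $g^{-n}(p)$ denotes the set of patterns $q$ with domain $D + [-n,n]^2$ (discrete intervals) that evolve into $p$ in $n$ steps, i.e. such that $g^n(y)|_D = p$ for every (equivalently, some) configuration $y \in \{0,1\}^{\mathbb{Z}^2}$ with $y|_{D+[-n,n]^2} = q$. The output pattern is encoded as a binary string listing the cells of a box containing the origin and the domain. *)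

(* Defs.v *)
From HB Require Import structures.
From mathcomp Require Import all_boot all_order all_algebra.
From mathcomp Require Import finmap.
From mathcomp Require Import boolp classical_sets.

Set Implicit Arguments.
Unset Strict Implicit.
Unset Printing Implicit Defensive.

Import GRing.Theory.

Local Open Scope fset_scope.
Local Open Scope ring_scope.

Definition config : Type := (int * int)%type -> bool.
Definition pattern : Type := {fmap (int * int) -> bool}.

Definition moore : seq (int * int) :=
  [seq u <- [seq (i, j) | i <- [:: -1; 0; 1], j <- [:: -1; 0; 1]] | u != 0].

Definition life (x : config) : config := fun v =>
  let s := (\sum_(u <- moore) x (v + u)%R)%N in
  (~~ x v && (s == 3%N)) || (x v && (s \in [:: 2%N; 3%N])).

(* The discrete interval [-a, b], in increasing order. *)
Definition zint (a b : nat) : seq int :=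
  [seq i%:Z - a%:Z | i <- iota 0 (a + b).+1].

Definition square (n : nat) : seq (int * int) :=
  [seq (i, j) | i <- zint n n, j <- zint n n].

Definition restr (y : config) (D : {fset int * int}) : pattern :=
  [fmap v : D => y (val v)].

Definition thicken (D : {fset int * int}) (n : nat) : {fset int * int} :=
  [fset v + u | v in D, u in square n].

Definition life_preim (n : nat) (p : pattern) : set pattern :=
  [set q | domf q = thicken (domf p) n /\
     forall y : config, restr y (domf q) = q ->
       restr (iter n life y) (domf p) = p]%classic.

(* A cell of the box outside the domain is 00; one in the domain with value b
   is 1b. *)
Definition cell_code (p : pattern) (v : int * int) : seq bool :=
  if p.[? v]%fmap is Some b then [:: true; b] else [:: false; false].

Definition unary (a : nat) : seq bool := rcons (nseq a true) false.

(* w lists, row by row, the cells of some box [-a, b] x [-c, d] that contains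
   the domain of p; a, b, c, d precede the cells so that w determines p. *)
Definition encodes (w : seq bool) (p : pattern) : Prop :=
  exists a b c d : nat,
    {in domf p, forall v, (v.1 \in zint a b) && (v.2 \in zint c d)} /\
    w = unary a ++ unary b ++ unary c ++ unary d ++
        flatten [seq cell_code p (i, j) | j <- zint c d, i <- zint a b].

Inductive move := MoveLeft | Stay | MoveRight.

Definition move_shift (m : move) : int :=
  match m with MoveLeft => -1 | Stay => 0 | MoveRight => 1 end.

(* Deterministic multitape Turing machines with two-way infinite tapes. The
   tape alphabet is option (bool + tm_aux), None being the blank. *)
Record tm := TM {
  tm_ntapes : nat;  (* number of tapes minus one *)
  tm_state : finType;
  tm_aux : finType;
  tm_start : tm_state;
  tm_halt : tm_state;
  tm_trans : tm_state -> {ffun 'I_tm_ntapes.+1 -> option (bool + tm_aux)} ->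
    tm_state * {ffun 'I_tm_ntapes.+1 -> option (bool + tm_aux) * move}
}.

Definition tm_symbol (M : tm) : Type := option (bool + tm_aux M).

Record tm_conf (M : tm) := TMConf {
  tm_cur : tm_state M;
  tm_head : 'I_(tm_ntapes M).+1 -> int;
  tm_tape : 'I_(tm_ntapes M).+1 -> int -> tm_symbol M
}.

Definition tm_step (M : tm) (c : tm_conf M) : tm_conf M :=
  if tm_cur c == tm_halt M then c else
  let r := tm_trans (tm_cur c) [ffun i => tm_tape c i (tm_head c i)] in
  TMConf r.1
    (fun i => tm_head c i + move_shift (r.2 i).2)
    (fun i z => if z == tm_head c i then (r.2 i).1 else tm_tape c i z).

(* The tape with w on cells 0, ..., size w - 1 and blanks elsewhere. *)
Definition word_tape (M : tm) (w : seq bool) (z : int) : tm_symbol M :=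
  if z is Posz k then nth None [seq Some (inl b) | b <- w] k else None.

Definition tm_init (M : tm) (w : seq bool) : tm_conf M :=
  TMConf (tm_start M) (fun=> 0)
    (fun i => word_tape M (if i == ord0 then w else [::])).

(* The output is read off the last tape, which is also the input tape when
   the machine has a single tape. *)
Definition outputs_within (M : tm) (w : seq bool) (t : nat) (out : seq bool) :
    Prop :=
  let c := iter t (@tm_step M) (tm_init M w) in
  tm_cur c = tm_halt M /\ tm_tape c ord_max =1 word_tape M out.

(* Main.v *)
Require Import Defs.
From mathcomp Require Import all_boot all_order all_algebra.
From mathcomp Require Import finmap.
From mathcomp Require Import boolp classical_sets.
From mathcomp Require Import zify.

(** The diagonal agar with value [f (i + j + p)] at [(i, j)], where [f] is
[1 0 0 1 0 0 0 1] repeated with period 8, is mapped by [life] to itself with [p + 5] in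
place of [p]. It is rigid: if the image of a configuration is this agar on a large
rectangle, then the configuration itself is the agar on a smaller rectangle, which loses
a constant number of cells above, below and on the right, but gains one column on the
left. Rigidity is proved by computation. For each of the eight phases one keeps the set
of strips of three rows that may occur, and removes strips with no compatible neighbour
to the right, above or below, until the first cell is determined. Because neighbours to
the left are not consulted, the leftmost column that influences the image is determined
too.

The witness for [n] has two rectangular patches: the agar on the right and its mirror
image on the left, with a gap of [2 * n] columns outside the domain. Forward in time, a
half plane of agar loses one column per step whatever lies beside it, so the two agars
put side by side evolve in [n] steps to a configuration that contains the witness.
Backward in time each patch gains one column per step, so after [n + 1] steps the two
patches overlap, and they disagree there. *)

Set Implicit Arguments.
Unset Strict Implicit.
Unset Printing Implicit Defensive.

Import Order.TTheory GRing.Theory Num.Theory.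

Local Open Scope ring_scope.
Local Open Scope classical_set_scope.

(** * Rigidity of the agar *)

(* The agar with value stripe (i + j + p) at (i, j): one step of life adds 5 to p. *)
Definition stripe (k : nat) : bool :=
  nth false [:: true; false; false; true; false; false; false; true] (k %% 8).

Definition phase (z : int) : nat := `|(z %% 8)%Z|%N.

Definition agar (z : int) : bool := stripe (phase z).

Lemma phase_lt z : (phase z < 8)%N.
Proof. rewrite /phase; lia. Qed.

Lemma phaseD z (k : nat) : phase (z + k%:Z) = ((phase z + k) %% 8)%N.
Proof. rewrite /phase; lia. Qed.

Lemma agarD z (k : nat) : agar (z + k%:Z) = stripe (phase z + k).
Proof. by rewrite /agar phaseD /stripe modn_mod. Qed.

Lemma agar_eqmod z z' : (z = z' %[mod 8])%Z -> agar z = agar z'.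
Proof. by rewrite /agar /phase => ->. Qed.

(* A trie is a set of horizontal strips of height three, read column by column
   from the left and three cells per column; l = 0, 1, 2 below is the row of the
   next cell to be read. A leaf Anything accepts every continuation. *)
Inductive trie := Nothing | Anything | Branch of trie & trie.

(** Collapsing equal leaves keeps an empty set syntactically [Nothing], which is what [first_bit]
    looks for. *)
Definition branch s t :=
  match s, t with
  | Nothing, Nothing => Nothing
  | Anything, Anything => Anything
  | _, _ => Branch s t
  end.

Fixpoint meet s t :=
  match s, t with
  | Nothing, _ | _, Nothing => Nothing
  | Anything, _ => t
  | _, Anything => s
  | Branch a b, Branch c d => branch (meet a c) (meet b d)
  end.

Fixpoint join s t :=
  match s, t with
  | Anything, _ | _, Anything => Anything
  | Nothing, _ => t
  | _, Nothing => s
  | Branch a b, Branch c d => branch (join a c) (join b d)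
  end.

(** This only enlarges the set. It bounds the depth, since each [shift] would otherwise lengthen the
    strips by a column. *)
Fixpoint trunc n t :=
  match n, t with
  | _, Nothing => Nothing
  | n'.+1, Branch a b => branch (trunc n' a) (trunc n' b)
  | _, _ => Anything
  end.

Definition free t := branch t t.

Definition next_row l := if l is 2%N then 0%N else l.+1.

Definition shift t := free (free (free t)).

(* If the strip one row further (resp. back) lies in t, then this strip lies in
   down 0 t (resp. up 0 t): two rows are shared, the third one is projected away. *)
Fixpoint down l t :=
  if t is Branch a b then
    let a' := down (next_row l) a in let b' := down (next_row l) b in
    match l with
    | 0 => free (branch a' b')
    | 1 => branch a' b'
    | _ => join a' b'
    end
  else t.

Fixpoint up l t :=
  if t is Branch a b then
    let a' := up (next_row l) a in let b' := up (next_row l) b in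
    match l with
    | 0 => join a' b'
    | 1 => branch a' b'
    | _ => branch (free a') (free b')
    end
  else t.

Fixpoint build n (P : seq bool -> bool) :=
  if n is n'.+1 then
    branch (build n' (fun s => P (false :: s))) (build n' (fun s => P (true :: s)))
  else if P [::] then Anything else Nothing.

(* s lists a 3 x 3 block by columns, so that the count includes the centre, at index 4. *)
Definition rule (s : seq bool) : bool :=
  let k := count id s in (k == 3%N) || ((k == 4%N) && nth false s 4).

(* The k-th set concerns strips whose first cell has phase k; the centre of the first
   3 x 3 block has phase k + 2, hence k + 7 one step later. *)
Definition constraints : seq trie :=
  [seq build 9 (fun s => rule s == stripe (k + 7)) | k <- iota 0 8].

(* No information is taken from the strip on the left, which is why strips may start
   one column to the left of the region where the image is known. *)
Definition refine w (A : seq trie) : seq trie :=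
  [seq meet (meet (trunc w (meet (nth Anything A k)
                                 (shift (nth Anything A (k.+1 %% 8)))))
                  (down 0 (nth Anything A (k.+1 %% 8))))
            (up 0 (nth Anything A ((k + 7) %% 8))) | k <- iota 0 8].

Definition first_bit (b : bool) t : bool :=
  if t is Branch s s' then if (if b then s else s') is Nothing then true else false
  else false.

(* 65 rounds on strips of seven columns leave no choice for the first cell. *)
Lemma refined : let A := iter 65 (refine 21) constraints in
  all (fun k => first_bit (stripe k) (nth Anything A k)) (iota 0 8).
Proof. by vm_compute. Qed.

(** * Soundness of the trie operations *)

Fixpoint strip_in l t (y : config) (i j : int) : bool :=
  match t with
  | Nothing => false
  | Anything => true
  | Branch a b =>
    let i' := if l is 2%N then i + 1 else i in
    if y (i, j + l%:Z) then strip_in (next_row l) b y i' j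
    else strip_in (next_row l) a y i' j
  end.

Lemma strip_in_branch l s t y i j :
  strip_in l (branch s t) y i j = strip_in l (Branch s t) y i j.
Proof. by case: s t => [||s s'] [||t t'] //=; case: ifP. Qed.

Lemma strip_in_free l t y i j :
  strip_in l (free t) y i j = strip_in (next_row l) t y (if l is 2%N then i + 1 else i) j.
Proof. by rewrite strip_in_branch /=; case: ifP. Qed.

Lemma strip_in_meet l s t y i j :
  strip_in l (meet s t) y i j = strip_in l s y i j && strip_in l t y i j.
Proof.
elim: s t l i => [|t|a IHa b IHb [||c d]] l i //=; first by case: t.
- by rewrite andbF.
- by rewrite andbT.
by rewrite strip_in_branch /=; case: ifP; rewrite (IHa, IHb).
Qed.

Lemma strip_in_join l s t y i j :
  strip_in l (join s t) y i j = strip_in l s y i j || strip_in l t y i j.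
Proof.
elim: s t l i => [t|t|a IHa b IHb [||c d]] l i //=; try by case: t.
- by rewrite orbF.
- by rewrite orbT.
by rewrite strip_in_branch /=; case: ifP; rewrite (IHa, IHb).
Qed.

Lemma strip_in_trunc n l t y i j :
  strip_in l t y i j -> strip_in l (trunc n t) y i j.
Proof.
elim: n t l i => [|n IHn] [||a b] l i //=.
by rewrite strip_in_branch /=; case: ifP => _; apply: IHn.
Qed.

Lemma strip_in_shift t y i j :
  strip_in 0 (shift t) y i j = strip_in 0 t y (i + 1) j.
Proof. by rewrite !strip_in_free. Qed.

(** The induction on the trie cycles through the rows, so the three cases are proved together. Row
    [l] of the strip at [j + 1] is row [l + 1] of the strip at [j]; its row 2 is projected away by
    [join], and row 0 at [j] is left free. *)
Lemma strip_in_down t y i j :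
  [/\ strip_in 0 t y i (j + 1) -> strip_in 0 (down 0 t) y i j,
      strip_in 1 t y i (j + 1) -> strip_in 2 (down 1 t) y i j &
      strip_in 2 t y i (j + 1) -> strip_in 0 (down 2 t) y (i + 1) j].
Proof.
elim: t i => [||a IHa b IHb] i //; split.
- rewrite /= strip_in_free strip_in_branch /= addr0.
  by have [_ Ha _] := IHa i; have [_ Hb _] := IHb i; case: ifP.
- rewrite /= strip_in_branch /= -addrA (_ : 1 + 1%:Z = 2%:Z) //.
  by have [_ _ Ha] := IHa i; have [_ _ Hb] := IHb i; case: ifP.
rewrite /= strip_in_join.
have [Ha _ _] := IHa (i + 1); have [Hb _ _] := IHb (i + 1).
by case: ifP => _ H; apply/orP; [right; apply: Hb|left; apply: Ha].
Qed.

(** The same induction in the other direction: row 0 is projected away and row 2 is left free. *)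
Lemma strip_in_up t y i j :
  [/\ strip_in 0 t y i (j - 1) -> strip_in 0 (up 0 t) y i j,
      strip_in 1 t y i (j - 1) -> strip_in 0 (up 1 t) y i j &
      strip_in 2 t y i (j - 1) -> strip_in 1 (up 2 t) y i j].
Proof.
elim: t i => [||a IHa b IHb] i //; split.
- rewrite /= strip_in_join.
  have [_ Ha _] := IHa i; have [_ Hb _] := IHb i.
  by case: ifP => _ H; apply/orP; [right; apply: Hb|left; apply: Ha].
- rewrite /= strip_in_branch /= subrK addr0.
  by have [_ _ Ha] := IHa i; have [_ _ Hb] := IHb i; case: ifP.
rewrite /= strip_in_branch /= (_ : j - 1 + 2%:Z = j + 1%:Z); last by lia.
rewrite !strip_in_free /=.
by have [Ha _ _] := IHa (i + 1); have [Hb _ _] := IHb (i + 1); case: ifP.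
Qed.

Fixpoint strip_bits n l (y : config) i j : seq bool :=
  if n is n'.+1 then
    y (i, j + l%:Z) :: strip_bits n' (next_row l) y (if l is 2%N then i + 1 else i) j
  else [::].

Lemma strip_in_build n P l y i j :
  strip_in l (build n P) y i j = P (strip_bits n l y i j).
Proof.
elim: n P l i => [|n IHn] P l i /=; first by case: ifP.
by rewrite strip_in_branch /=; case: ifP => _; rewrite IHn.
Qed.

Lemma mooreE : moore = [:: (-1, -1); (-1, 0); (-1, 1); (0, -1); (0, 1);
                           (1, -1); (1, 0); (1, 1)].
Proof. by []. Qed.

(** With the centre counted, birth and survival on two neighbours both give 3, and survival on three
    gives 4. *)
Lemma lifeE (y : config) i j :
  life y (i, j) = rule [:: y (i - 1, j - 1); y (i - 1, j); y (i - 1, j + 1);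
                           y (i, j - 1); y (i, j); y (i, j + 1);
                           y (i + 1, j - 1); y (i + 1, j); y (i + 1, j + 1)].
Proof.
rewrite /life mooreE !big_cons big_nil /rule /=.
rewrite !(_ : forall u, (i, j) + u = (i + u.1, j + u.2)) //= !addr0.
by do 9!case: (y _).
Qed.

Lemma life_strip y i j : life y (i + 1, j + 1) = rule (strip_bits 9 0 y i j).
Proof. by rewrite lifeE /= !addrK !addr0 -!addrA. Qed.

Section Backward.
Variables (y : config) (p x X a b : int).
Hypothesis image_agar : forall i j, x <= i < X -> a <= j < b ->
  life y (i, j) = agar (i + j + p + 5).

(** Each round consults the strips to the right, above and below, so those three bounds shrink by
    one. The left bound stays at [x - 1], where the first 3 x 3 block is centred on column [x]. *)
Lemma strip_in_refine n i j :
    x - 1 <= i < X - 1 - n%:Z -> a - 1 + n%:Z <= j < b - 1 - n%:Z ->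
  strip_in 0 (nth Anything (iter n (refine 21) constraints) (phase (i + j + p))) y i j.
Proof.
elim: n i j => [|n IHn] i j Hi Hj.
  rewrite (nth_map 0%N) ?size_iota ?phase_lt // nth_iota ?phase_lt // add0n.
  rewrite strip_in_build -life_strip image_agar; [|lia|lia].
  by rewrite -agarD (_ : i + 1 + (j + 1) + p + 5 = i + j + p + 7%:Z) //; lia.
rewrite iterS (nth_map 0%N) ?size_iota ?phase_lt // nth_iota ?phase_lt // add0n.
have ph1 : ((phase (i + j + p)).+1 %% 8)%N = phase (i + j + p + 1).
  by rewrite (phaseD _ 1) addn1.
have ph7 : ((phase (i + j + p) + 7) %% 8)%N = phase (i + j + p - 1).
  by rewrite -phaseD /phase; lia.
rewrite ph1 ph7 !strip_in_meet -!andbA; apply/and3P; split.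
- apply: strip_in_trunc; rewrite strip_in_meet strip_in_shift IHn; [|lia|lia].
  rewrite (_ : i + j + p + 1 = i + 1 + j + p); last by lia.
  by apply: IHn; lia.
- have [down_in _ _] := strip_in_down (nth Anything (iter n (refine 21) constraints)
                          (phase (i + j + p + 1))) y i j.
  apply: down_in; rewrite (_ : i + j + p + 1 = i + (j + 1) + p); last by lia.
  by apply: IHn; lia.
have [up_in _ _] := strip_in_up (nth Anything (iter n (refine 21) constraints)
                      (phase (i + j + p - 1))) y i j.
apply: up_in; rewrite (_ : i + j + p - 1 = i + (j - 1) + p); last by lia.
by apply: IHn; lia.
Qed.

(** By [refined], 65 rounds force the first cell of a strip. With the initial block this costs 66
    cells on the right and at [b]; the margin at [a] is rounded up for symmetry. *)
Lemma agar_backward i j :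
  x - 1 <= i < X - 66 -> a + 66 <= j < b - 66 -> y (i, j) = agar (i + j + p).
Proof.
move=> Hi Hj.
have := @strip_in_refine 65 i j; move: (allP refined (phase (i + j + p))).
rewrite mem_iota phase_lt => /(_ isT); rewrite /agar.
move: (nth _ _ _) (stripe _) => t v first_t in_t.
have {in_t}: strip_in 0 t y i j by apply: in_t; lia.
move: first_t; case: t => //= s t; rewrite addr0.
by case: v; case: (y _); case: s; case: t.
Qed.

End Backward.

(** * The witnesses *)

(** Only the phase of [z] matters, which leaves eight cases. The centre is [agar (z + 2)], so a step
    adds 5. *)
Lemma rule_agar z :
  rule [:: agar z; agar (z + 1); agar (z + 2); agar (z + 1); agar (z + 2);
           agar (z + 3); agar (z + 2); agar (z + 3); agar (z + 4)] = agar (z + 7).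
Proof.
rewrite -[X in [:: agar X & _]]addr0 !(agarD z 0, agarD z 1, agarD z 2, agarD z 3,
  agarD z 4, agarD z 7).
by case: (phase z) (phase_lt z); do 8?case.
Qed.

Lemma agar_forward (y : config) (p x : int) :
    (forall i j, x <= i -> y (i, j) = agar (i + j + p)) ->
  forall i j, x + 1 <= i -> life y (i, j) = agar (i + j + p + 5).
Proof.
move=> y_agar i j Hi; rewrite lifeE !y_agar; try lia.
rewrite (_ : i + j + p + 5 = i + j + p - 2 + 7) -?rule_agar; last by lia.
by congr (rule [:: agar _; agar _; agar _; agar _; agar _; agar _; agar _; agar _;
                  agar _]); lia.
Qed.

Lemma agar_forward_iter n (y : config) (p x : int) :
    (forall i j, x <= i -> y (i, j) = agar (i + j + p)) ->
  forall i j, x + n%:Z <= i -> iter n life y (i, j) = agar (i + j + p + 5 * n%:Z).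
Proof.
move=> y_agar; elim: n => [|n IHn] i j Hi.
  by rewrite /= mulr0 addr0; apply: y_agar; lia.
rewrite iterS (@agar_forward _ (p + 5 * n%:Z) (x + n%:Z)).
- by congr agar; lia.
- by move=> i' j' Hi'; rewrite IHn // !addrA.
by lia.
Qed.

Lemma agar_backward_iter n (y : config) (p x X a b : int) :
    (forall i j, x <= i < X -> a <= j < b ->
       iter n life y (i, j) = agar (i + j + p + 5 * n%:Z)) ->
  forall i j, x - n%:Z <= i < X - 66 * n%:Z -> a + 66 * n%:Z <= j < b - 66 * n%:Z ->
    y (i, j) = agar (i + j + p).
Proof.
elim: n x X a b => [|n IHn] x X a b image_agar i j Hi Hj.
  by have := image_agar i j; rewrite /= mulr0 addr0; apply; lia.
apply: (IHn (x - 1) (X - 66) (a + 66) (b - 66)); [|lia|lia].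
move=> i' j' Hi' Hj'; rewrite -addrA.
(* The last step is undone first: this applies to [iter n life y], whose agar has offset
   [p + 5 * n]. *)
apply: (@agar_backward _ (p + 5 * n%:Z) x X a b) => // i1 j1 Hi1 Hj1.
by have := image_agar i1 j1 Hi1 Hj1; rewrite iterS => ->; congr agar; lia.
Qed.

(** Rigidity gains a column on the left only; reflection transfers it to the agar of opposite slope,
    which gains one on the right. *)
Definition mirror (s : int) (y : config) : config := fun v => y (s - v.1, v.2).

Lemma mirrorK s : involutive (mirror s).
Proof.
by move=> y; apply: funext => -[i j]; rewrite /mirror /=; congr (y (_, _)); lia.
Qed.

Lemma life_mirror s y : life (mirror s y) = mirror s (life y).
Proof.
apply: funext => -[i j]; rewrite /mirror /= !lifeE /=.
rewrite (_ : s - (i - 1) = s - i + 1); last by lia.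
rewrite (_ : s - (i + 1) = s - i - 1); last by lia.
by rewrite /rule; do 9!case: (y _).
Qed.

Lemma iter_life_mirror n s y : iter n life (mirror s y) = mirror s (iter n life y).
Proof. by elim: n => // n IHn; rewrite !iterS IHn life_mirror. Qed.

Lemma iter_life_local n (y z : config) i j :
    (forall i' j', i - n%:Z <= i' <= i + n%:Z -> j - n%:Z <= j' <= j + n%:Z ->
       y (i', j') = z (i', j')) ->
  iter n life y (i, j) = iter n life z (i, j).
Proof.
elim: n i j => [|n IHn] i j yz; first by rewrite /= yz //; lia.
by rewrite !iterS !lifeE !IHn // => i' j' Hi' Hj'; apply: yz; lia.
Qed.

(** * Restrictions and preimages *)

Lemma fnd_restr (y : config) D v :
  (restr y D).[? v]%fmap = if v \in D then Some (y v) else None.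
Proof.
case: ifP => vD; last by rewrite not_fnd //= vD.
by rewrite (in_fnd (vD : v \in domf (restr y D))) ffunE.
Qed.

Lemma restr_eqP (y z : config) D :
  restr y D = restr z D <-> {in D, forall v, y v = z v}.
Proof.
split=> [eq_yz v vD|yz].
  by have := fnd_restr y D v; rewrite eq_yz fnd_restr vD => -[].
by apply/fmapP => v; rewrite !fnd_restr; case: ifP => // /yz ->.
Qed.

(** Extension by dead cells: it supplies an instance for the universally quantified condition in
    [life_preim]. *)
Definition config_of (q : pattern) : config := fun v => odflt false q.[? v]%fmap.

Lemma restr_config_of q : restr (config_of q) (domf q) = q.
Proof.
apply/fmapP => v; rewrite fnd_restr /config_of.
by case: ifP => vq; [rewrite (in_fnd vq) | rewrite not_fnd ?vq].
Qed.

Lemma mem_zint a b (z : int) : (z \in zint a b) = (- a%:Z <= z <= b%:Z).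
Proof.
apply/mapP/idP => [[i]|Hz]; first by rewrite mem_iota => ? ->; lia.
by exists (absz (z + a%:Z)); [rewrite mem_iota|]; lia.
Qed.

Lemma mem_square n i j :
  ((i, j) \in square n) = (- n%:Z <= i <= n%:Z) && (- n%:Z <= j <= n%:Z).
Proof.
rewrite -!mem_zint; apply/allpairsP/andP => [[[i' j'] [? ? [-> ->]]] // | [Hi Hj]].
by exists (i, j).
Qed.

Lemma life_preim_restr n (y : config) D :
  life_preim n (restr (iter n life y) D) (restr y (thicken D n)).
Proof.
split=> // z /restr_eqP zy; apply/restr_eqP => -[i j] ijD.
apply: iter_life_local => i' j' Hi Hj; apply: zy.
rewrite (_ : (i', j') = (i, j) + (i' - i, j' - j)).
  by apply/imfset2P; exists (i, j) => //; exists (i' - i, j' - j) => //=;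
     rewrite mem_square; lia.
by congr (_, _); rewrite /= addrC subrK.
Qed.

(* In n + 1 steps back, each patch loses 66 (n + 1) cells on three of its sides; 136 is
   a multiple of 8 that is large enough. *)
Definition side n : nat := (136 * (n + 2))%N.

(** In either patch the value depends on the row plus the distance to the edge of the gap, so the
    patches mirror each other. *)
Definition target n : config := fun v =>
  if v.1 < (side n)%:Z then agar ((side n)%:Z - 1 - v.1 + v.2)
  else agar (v.1 - (side n + 2 * n)%:Z + v.2).

(* The preimage of target n under n steps: the two patches meet at column side n + n. *)
Definition seam n : config := fun v =>
  if v.1 < (side n + n)%:Z then agar ((side n)%:Z - 1 - v.1 + v.2 - 5 * n%:Z)
  else agar (v.1 - (side n + 2 * n)%:Z + v.2 - 5 * n%:Z).

Definition columns n : seq nat := iota 0 (side n) ++ iota (side n + 2 * n) (side n).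

Definition domain n : {fset int * int} :=
  [fset (i%:Z, j%:Z) | i in columns n, j in iota 0 (side n)]%fset.

Definition witness n : pattern := restr (target n) (domain n).

Lemma mem_domain n i j : ((i, j) \in domain n) =
  ((0 <= i < (side n)%:Z) || ((side n + 2 * n)%:Z <= i < (2 * side n + 2 * n)%:Z))
  && (0 <= j < (side n)%:Z).
Proof.
apply/imfset2P/idP => [[a /= Ha [b /= Hb [-> ->]]]|Hij].
  by move: Ha Hb; rewrite mem_cat !mem_iota; lia.
have Hi : absz i \in columns n by rewrite mem_cat !mem_iota; lia.
have Hj : absz j \in iota 0 (side n) by rewrite mem_iota; lia.
apply: (ex_intro2 _ _ (absz i)) => //; apply: (ex_intro2 _ _ (absz j)) => //.
by congr (_, _); lia.
Qed.

Lemma iter_seam n v : v \in domain n -> iter n life (seam n) v = target n v.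
Proof.
case: v => i j; rewrite mem_domain /target /= => Hij.
case: ifP => Hi.
  rewrite -[seam n](mirrorK ((side n)%:Z - 1)).
  rewrite iter_life_mirror {1}/mirror /=.
  (* The reflection turns the half plane left of column [side n + n] into columns from [- n] on;
     after [n] steps its edge is at 0, the edge of the reflected patch. *)
  rewrite (@agar_forward_iter n _ (- (5 * n%:Z)) (- n%:Z)); [|move=> i' j' Hi'|lia].
    by congr agar; lia.
  by rewrite /mirror /seam /= ifT; [congr agar|]; lia.
rewrite (@agar_forward_iter n _ (- (side n + 2 * n)%:Z - 5 * n%:Z) (side n + n)%:Z).
- by congr agar; lia.
- by move=> i' j' Hi'; rewrite /seam /= ifF; [congr agar|]; lia.
by lia.
Qed.

Lemma witness_preim n : life_preim n (witness n) !=set0.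
Proof.
exists (restr (seam n) (thicken (domain n) n)).
have -> : witness n = restr (iter n life (seam n)) (domain n).
  by apply/restr_eqP => v vD; rewrite iter_seam.
exact: life_preim_restr.
Qed.

Lemma witness_no_preim n : life_preim n.+1 (witness n) = set0.
Proof.
apply/seteqP; split=> // q [_ Hq]; have {Hq} := Hq _ (restr_config_of q).
move: (config_of q) => y /restr_eqP y_target.
have sideE : side n = (136 * (n + 2))%N by [].
(* Column [side n + n] is the last one that the left patch reaches in [n + 1] steps back, and the
   right patch reaches it too. Row [70 * n.+1] survives the loss of 66 cells per step; as 70 - 5 - 1
   = 64 is a multiple of 8, the two values are [agar 1] and [agar 0]. *)
have y_right : y ((side n + n)%:Z, (70 * n.+1)%:Z) = agar (64 * n.+1%:Z + 1).
  rewrite (@agar_backward_iter n.+1 y (- (side n + 2 * n)%:Z - 5 * n.+1%:Z)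
             (side n + 2 * n)%:Z (2 * side n + 2 * n)%:Z 0 (side n)%:Z); try lia.
    by congr agar; lia.
  move=> i j Hi Hj; rewrite y_target ?mem_domain; last by lia.
  by rewrite /target /= ifF; [congr agar|]; lia.
have y_left : y ((side n + n)%:Z, (70 * n.+1)%:Z) = agar (64 * n.+1%:Z).
  rewrite -[y](mirrorK ((side n)%:Z - 1)).
  rewrite {1}/mirror /=.
  rewrite (@agar_backward_iter n.+1 _ (- (5 * n.+1%:Z)) 0 (side n)%:Z 0 (side n)%:Z);
    try lia.
    by congr agar; lia.
  move=> i j Hi Hj; rewrite iter_life_mirror /mirror y_target ?mem_domain;
    last by rewrite /=; lia.
  by rewrite /target /= ifT; [congr agar|]; lia.
move: y_right; rewrite y_left.
have -> : agar (64 * n.+1%:Z) = agar 0 by apply: agar_eqmod; lia.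
by have -> : agar (64 * n.+1%:Z + 1) = agar 1 by apply: agar_eqmod; lia.
Qed.

(** * Multitape machines for nested loops *)

(* Tape 0 (counter false) holds the input, tape 1 (counter true) a copy of it made with
   Push, and Write appends to the output. Jump i l goes to l if tape i reads a blank. *)
Inductive instr :=
  | Write of bool
  | Push
  | Move of bool & move
  | Jump of bool & nat
  | Goto of nat.

Definition counter (i : bool) : 'I_3 := if i then inord 1 else ord0.

Definition exec (T : Type) (c : instr) (q : nat) (x : {ffun 'I_3 -> option (bool + T)}) :
    nat * {ffun 'I_3 -> option (bool + T) * move} :=
  match c with
  | Write b => (q.+1, [ffun k => if k == ord_max then (Some (inl b), MoveRight)
                                 else (x k, Stay)])
  | Push => (q.+1, [ffun k => if k == counter true then (Some (inl true), MoveRight)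
                              else (x k, Stay)])
  | Move i d => (q.+1, [ffun k => (x k, if k == counter i then d else Stay)])
  | Jump i l => (if x (counter i) is None then l else q.+1, [ffun k => (x k, Stay)])
  | Goto l => (l, [ffun k => (x k, Stay)])
  end.

(** The state is the program counter; the machine halts at the address just after the last
    instruction. *)
Definition machine (prog : seq instr) : tm :=
  @TM 2 'I_(size prog).+1 void ord0 ord_max
    (fun q x => let r := exec (nth Push prog q) q x in (inord r.1, r.2)).

Definition set_head (h : bool -> int) (i : bool) (z : int) : bool -> int :=
  fun j => if j == i then z else h j.

(** Jumps are absolute, so [o] is the address of this block. The head walks left to the blank at -1,
    then steps back to 0. *)
Definition rewind (i : bool) (o : nat) : seq instr :=
  [:: Move i MoveLeft; Jump i (o + 3); Goto o; Move i MoveRight].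

Lemma ord3P (k : 'I_3) : [\/ k = ord0, k = inord 1 | k = ord_max].
Proof.
case: k => -[|[|[|//]]] lt_k3; [constructor 1|constructor 2|constructor 3];
  by apply: val_inj; rewrite /= ?inordK.
Qed.

(** * Execution of instructions, rewinding and copying *)

Section Machine.
Variables (prog : seq instr) (n : nat).

Local Notation M := (machine prog).

Definition conf (q : nat) (h : bool -> int) (m : nat) (out : seq bool) : tm_conf M :=
  @TMConf M (inord q : 'I_(size prog).+1)
    (fun k : 'I_3 => if k == ord0 then h false else
                     if k == inord 1 then h true else (size out)%:Z)
    (fun k : 'I_3 => @word_tape M (if k == ord0 then nseq n true else
                     if k == inord 1 then nseq m true else out)).

Definition located (o : nat) (c : seq instr) : Prop :=
  exists s t : seq instr, prog = s ++ c ++ t /\ size s = o.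

Lemma located_cat o c d : located o (c ++ d) -> located o c /\ located (o + size c) d.
Proof.
move=> [s [t [progE <-]]]; split; first by exists s, (d ++ t); rewrite progE !catA.
by exists (s ++ c), t; rewrite size_cat progE !catA.
Qed.

Lemma located_cons o c d :
  located o (c :: d) -> [/\ (o < size prog)%N, nth Push prog o = c & located o.+1 d].
Proof.
move=> [s [t [progE <-]]]; split; last first.
- by exists (rcons s c), t; rewrite cat_rcons size_rcons progE.
- by rewrite progE nth_cat ltnn subnn.
by rewrite progE size_cat /=; lia.
Qed.

Lemma inord1_neq : [/\ (inord 1 == ord0 :> 'I_3) = false,
  (ord0 == inord 1 :> 'I_3) = false, (ord_max == inord 1 :> 'I_3) = false &
  (inord 1 == ord_max :> 'I_3) = false].
Proof. by split; rewrite -val_eqE /= inordK. Qed.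

Lemma word_tape_blank m z : (0 <= z < m%:Z) = false -> @word_tape M (nseq m true) z = None.
Proof.
by case: z => // k; rewrite /= => Hk; rewrite nth_default // size_map size_nseq; lia.
Qed.

Lemma word_tape_mark m z : 0 <= z < m%:Z -> @word_tape M (nseq m true) z = Some (inl true).
Proof.
case: z => [k|k] Hk; last by lia.
by rewrite /= (nth_map true) ?size_nseq ?nth_nseq ?if_same //; lia.
Qed.

Lemma word_tape_rcons w b z :
  (if z == (size w)%:Z then Some (inl b) else @word_tape M w z) = @word_tape M (rcons w b) z.
Proof.
case: z => [k|k] //; rewrite /= map_rcons nth_rcons size_map eqz_nat.
by case: ltngtP => // Hk; rewrite nth_default // size_map ltnW.
Qed.

Lemma tm_stepE q h m out : (q < size prog)%N ->
  let c := conf q h m out in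
  let r := exec (nth Push prog q) q [ffun k => @tm_tape M c k (@tm_head M c k)] in
  tm_step c = @TMConf M (inord r.1 : 'I_(size prog).+1)
    (fun k => @tm_head M c k + move_shift (r.2 k).2)
    (fun k z => if z == @tm_head M c k then (r.2 k).1 else @tm_tape M c k z).
Proof.
move=> lt_q c r; rewrite /tm_step ifF.
  by rewrite /c /r /= inordK // ltnW.
by apply/eqP => /(congr1 (@nat_of_ord _)) /=; rewrite inordK; lia.
Qed.

Lemma tm_step_write q h m out b : (q < size prog)%N -> nth Push prog q = Write b ->
  tm_step (conf q h m out) = conf q.+1 h m (rcons out b).
Proof.
move=> lt_q prog_q; rewrite tm_stepE // prog_q /conf /=.
have [E10 E01 E21 E12] := inord1_neq.
congr TMConf; apply: funext => k; first by
  case: (ord3P k) => ->; rewrite ffunE ?eqxx ?E10 ?E01 ?E21 ?E12 ?size_rcons /=; lia.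
apply: funext => z; case: (ord3P k) => ->; rewrite !ffunE ?eqxx ?E10 ?E01 ?E21 ?E12 /=.
- by case: eqP => // ->.
- by case: eqP => // ->.
exact: word_tape_rcons.
Qed.

Lemma tm_step_push q h m out : (q < size prog)%N -> nth Push prog q = Push ->
  h true = m%:Z ->
  tm_step (conf q h m out) = conf q.+1 (set_head h true (m.+1)%:Z) m.+1 out.
Proof.
move=> lt_q prog_q hm; rewrite tm_stepE // prog_q /conf /=.
have [E10 E01 E21 E12] := inord1_neq.
congr TMConf; apply: funext => k; first by
  case: (ord3P k) => ->; rewrite ffunE ?eqxx ?E10 ?E01 ?E21 ?E12 /set_head /=; lia.
apply: funext => z; case: (ord3P k) => ->; rewrite !ffunE ?eqxx ?E10 ?E01 ?E21 ?E12 /=.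
- by case: eqP => // ->.
- have := word_tape_rcons (nseq m true) true z; rewrite size_nseq hm => ->.
  by rewrite -cats1 -(nseqD m 1) addn1.
by case: eqP => // ->.
Qed.

Lemma tm_step_move q h m out i d : (q < size prog)%N -> nth Push prog q = Move i d ->
  tm_step (conf q h m out) = conf q.+1 (set_head h i (h i + move_shift d)) m out.
Proof.
move=> lt_q prog_q; rewrite tm_stepE // prog_q /conf /=.
have [E10 E01 E21 E12] := inord1_neq.
congr TMConf; apply: funext => k; last first.
  by apply: funext => z; rewrite !ffunE /=; case: eqP => // ->.
by case: (ord3P k) => ->; case: i {prog_q} => /=;
   rewrite ffunE ?eqxx ?E10 ?E01 ?E21 ?E12 /set_head /= /= ?addr0.
Qed.

Lemma tm_step_goto q h m out l : (q < size prog)%N -> nth Push prog q = Goto l ->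
  tm_step (conf q h m out) = conf l h m out.
Proof.
move=> lt_q prog_q; rewrite tm_stepE // prog_q /conf /=.
congr TMConf; apply: funext => k; first by rewrite ffunE addr0.
by apply: funext => z; rewrite !ffunE /=; case: eqP => // ->.
Qed.

Lemma tm_step_jump q h m out i l : (q < size prog)%N -> nth Push prog q = Jump i l ->
  tm_step (conf q h m out) =
    conf (if 0 <= h i < (if i then m else n)%:Z then q.+1 else l) h m out.
Proof.
move=> lt_q prog_q; rewrite tm_stepE // prog_q /conf /=.
have [E10 E01 E21 E12] := inord1_neq.
rewrite ffunE /=; congr TMConf.
- case: i {prog_q} => /=; rewrite ?E10 ?eqxx /=;
  by case: ifP => Hi; [rewrite word_tape_mark|rewrite word_tape_blank].
- by apply: funext => k; rewrite ffunE addr0.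
by apply: funext => k; apply: funext => z; rewrite !ffunE /=; case: eqP => // ->.
Qed.

Lemma set_headK h i z z' : set_head (set_head h i z) i z' = set_head h i z'.
Proof. by apply: funext => j; rewrite /set_head; case: eqP. Qed.

Lemma set_head_id h i z : h i = z -> set_head h i z = h.
Proof. by move=> <-; apply: funext => j; rewrite /set_head; case: eqP => // ->. Qed.

Lemma set_head_eq h i z : set_head h i z i = z.
Proof. by rewrite /set_head eqxx. Qed.

Lemma run_rewind o i h m out (k : nat) :
    located o (rewind i o) -> (k <= if i then m else n)%N ->
  iter (3 * k + 3) (@tm_step M) (conf o (set_head h i k%:Z) m out) =
    conf (o + 4) (set_head h i 0) m out.
Proof.
move=> /located_cons[lt0 at0] /located_cons[lt1 at1] /located_cons[lt2 at2].
move=> /located_cons[lt3 at3 _].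
elim: k => [|k IHk] le_k.
  rewrite muln0 add0n !iterSr (tm_step_move _ _ _ lt0 at0) set_headK set_head_eq.
  rewrite (tm_step_jump _ _ _ lt1 at1) set_head_eq /= addn3.
  by rewrite (tm_step_move _ _ _ lt3 at3) set_headK set_head_eq addn4.
rewrite (_ : (3 * k.+1 + 3 = (3 * k + 3).+3)%N); last by lia.
rewrite 3!iterSr (tm_step_move _ _ _ lt0 at0) set_headK set_head_eq.
rewrite (_ : k.+1%:Z + move_shift MoveLeft = k%:Z); last by rewrite /=; lia.
rewrite (tm_step_jump _ _ _ lt1 at1) set_head_eq ifT; last by lia.
by rewrite (tm_step_goto _ _ _ lt2 at2); apply: IHk; lia.
Qed.

Lemma iterD_eq (T : Type) (g : T -> T) a b x y z :
  iter a g x = y -> iter b g y = z -> iter (a + b) g x = z.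
Proof. by move=> <- <-; rewrite addnC iterD. Qed.

(** Copying costs four steps per mark and one exit jump; each of the two rewinds costs
    [3 * n + 3]. *)
Lemma run_copy h :
    located 0 ([:: Jump false 4; Push; Move false MoveRight; Goto 0]
                 ++ rewind false 4 ++ rewind true 8) ->
    h false = 0 -> h true = 0 ->
  iter (10 * n + 7) (@tm_step M) (conf 0 h 0 [::]) = conf 12 h n [::].
Proof.
move=> /located_cat[copy /located_cat[rew0 rew1]] h0 h1.
have := copy => /located_cons[lt0 at0] /located_cons[lt1 at1] /located_cons[lt2 at2].
move=> /located_cons[lt3 at3 _].
pose g k := set_head (set_head h false k%:Z) true k%:Z.
have loop k : (k <= n)%N -> iter (4 * k) (@tm_step M) (conf 0 h 0 [::]) = conf 0 (g k) k [::].
  elim: k => [|k IHk] lt_kn.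
    by rewrite muln0 /= /g !set_head_id //= /set_head; case: eqP => // ->.
  rewrite mulnSr; apply: (iterD_eq (IHk (ltnW lt_kn))).
  rewrite 4!iterSr (tm_step_jump _ _ _ lt0 at0) ifT; last by rewrite /g /set_head /=; lia.
  rewrite (tm_step_push _ lt1 at1) ?set_head_eq //.
  rewrite (tm_step_move _ _ _ lt2 at2) (tm_step_goto _ _ _ lt3 at3) /=.
  by congr conf; apply: funext => -[]; rewrite /g /set_head //=; lia.
rewrite (_ : (10 * n + 7 = 4 * n + (1 + ((3 * n + 3) + (3 * n + 3))))%N); last by lia.
apply: (iterD_eq (loop n (leqnn n))).
have exit : iter 1 (@tm_step M) (conf 0 (g n) n [::]) =
            conf 4 (set_head (set_head h true n%:Z) false n%:Z) n [::].
  rewrite /= (tm_step_jump _ _ _ lt0 at0) ifF; last by rewrite /g /set_head /=; lia.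
  by congr conf; apply: funext => -[].
apply: (iterD_eq exit).
apply: (iterD_eq (@run_rewind 4 false _ n _ n rew0 (leqnn n))).
rewrite (_ : set_head (set_head h true n%:Z) false 0 = set_head h true n%:Z); last first.
  by apply: set_head_id; rewrite /set_head.
by rewrite (@run_rewind 8 true _ n _ n rew1 (leqnn n)) set_head_id.
Qed.

End Machine.

(* Rep i c runs c once per mark on tape i, so nested repetitions need distinct tapes. *)
Inductive cmd :=
  | Emit of seq bool
  | Cat of cmd & cmd
  | Rep of bool & cmd.

Fixpoint eval (n : nat) (c : cmd) : seq bool :=
  match c with
  | Emit w => w
  | Cat c d => eval n c ++ eval n d
  | Rep _ c => flatten (nseq n (eval n c))
  end.

Fixpoint uses (i : bool) (c : cmd) : bool :=
  match c with
  | Emit _ => false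
  | Cat c d => uses i c || uses i d
  | Rep j c => (i == j) || uses i c
  end.

Fixpoint wf (c : cmd) : bool :=
  match c with
  | Emit _ => true
  | Cat c d => wf c && wf d
  | Rep i c => ~~ uses i c && wf c
  end.

(** The exit address [o + size s + 3] skips the leading [Jump], the body, [Move] and [Goto].
    Rewinding there lets an enclosing loop run this one again. *)
Fixpoint code (o : nat) (c : cmd) : seq instr :=
  match c with
  | Emit w => [seq Write b | b <- w]
  | Cat c d => code o c ++ code (o + size (code o c)) d
  | Rep i c =>
    let s := code o.+1 c in
    Jump i (o + size s + 3) ::
      (s ++ [:: Move i MoveRight; Goto o]) ++ rewind i (o + size s + 3)
  end.

(** The count is exact. Each round of a loop adds three steps of control and three of rewinding; 4
    is the exit jump plus the end of the rewind. *)
Fixpoint runtime (c : cmd) : {poly nat} :=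
  match c with
  | Emit w => (size w)%:P
  | Cat c d => runtime c + runtime d
  | Rep _ c => 'X * (runtime c + 6%:P) + 4%:P
  end.

Lemma runtime_rep i c n :
  (runtime (Rep i c)).[n] = (n * ((runtime c).[n] + 6) + 4)%N.
Proof. by rewrite /= !hornerD hornerM hornerX hornerD !hornerC. Qed.

(** Commands leave all counter heads where they found them, so they compose and repeat. By [wf], a
    loop body never tests or moves the counter of its own loop. *)
Lemma run_cmd prog n c o h out :
    located prog o (code o c) -> wf c -> (forall i, uses i c -> h i = 0) ->
  iter (runtime c).[n] (@tm_step (machine prog)) (conf prog n o h n out) =
    conf prog n (o + size (code o c)) h n (out ++ eval n c).
Proof.
elim: c o h out => [w|c IHc d IHd|i c IHc] o h out /=.
- move=> loc _ _; rewrite hornerC size_map.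
  elim: w o out loc => [|b w IHw] o out; first by rewrite addn0 cats0.
  move=> /located_cons[lt0 at0 loc].
  by rewrite iterSr (tm_step_write _ _ _ _ lt0 at0) IHw // addSnnS cat_rcons.
- move=> /located_cat[locc locd] /andP[wfc wfd] h0.
  rewrite hornerD size_cat addnA catA.
  apply: iterD_eq (IHc _ _ _ locc wfc _) (IHd _ _ _ locd wfd _) => i ui; apply: h0.
    by rewrite ui.
  by rewrite ui orbT.
move=> /located_cons[lt0 at0 /located_cat[/located_cat[locc locm] locr]].
move=> /andP[Nui wfc] h0; set s := code o.+1 c in locc locm locr at0 *.
have h0i : h i = 0 by apply: h0; rewrite eqxx.
have := locm; rewrite addSnnS => /located_cons[lt1 at1 /located_cons[lt2 at2 _]].
have len_i : (if i then n else n) = n by case: (i).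
have loop k : (k <= n)%N ->
    iter (k * ((runtime c).[n] + 3)) (@tm_step (machine prog)) (conf prog n o h n out) =
    conf prog n o (set_head h i k%:Z) n (out ++ flatten (nseq k (eval n c))).
  elim: k => [|k IHk] lt_kn; first by rewrite mul0n cats0 set_head_id.
  rewrite mulSnr; apply: (iterD_eq (IHk (ltnW lt_kn))).
  rewrite (_ : ((runtime c).[n] + 3 = 1 + ((runtime c).[n] + 2))%N); last by lia.
  have jump : iter 1 (@tm_step (machine prog))
      (conf prog n o (set_head h i k%:Z) n (out ++ flatten (nseq k (eval n c)))) =
      conf prog n o.+1 (set_head h i k%:Z) n (out ++ flatten (nseq k (eval n c))).
    by rewrite /= (tm_step_jump _ _ _ _ lt0 at0) set_head_eq len_i ifT; last lia.
  apply: (iterD_eq jump); apply: (iterD_eq (IHc _ _ _ locc wfc _)) => [j uj|].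
    rewrite /set_head; case: eqP => [ji|_]; first by rewrite -ji uj in Nui.
    by apply: h0; rewrite uj orbT.
  rewrite -/s addSnnS 2!iterSr (tm_step_move _ _ _ _ lt1 at1) (tm_step_goto _ _ _ _ lt2 at2).
  rewrite set_headK set_head_eq /= -catA; congr (conf _ _ _ (set_head _ _ _) _ (_ ++ _)).
    by lia.
  by elim: (k) => [|k' IH] /=; rewrite ?cats0 // -catA IH.
rewrite -[_.[n]]/((runtime (Rep i c)).[n]) runtime_rep.
rewrite (_ : (n * ((runtime c).[n] + 6) + 4 =
              n * ((runtime c).[n] + 3) + (1 + (3 * n + 3)))%N); last by lia.
apply: (iterD_eq (loop n (leqnn n))).
have jump : iter 1 (@tm_step (machine prog))
    (conf prog n o (set_head h i n%:Z) n (out ++ flatten (nseq n (eval n c)))) =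
    conf prog n (o + size s + 3) (set_head h i n%:Z) n (out ++ flatten (nseq n (eval n c))).
  by rewrite /= (tm_step_jump _ _ _ _ lt0 at0) set_head_eq len_i ifF; last lia.
apply: (iterD_eq jump).
rewrite (_ : (o.+1 + _)%N = (o + size s + 3)%N) in locr; last by rewrite size_cat /=; lia.
rewrite (@run_rewind prog n _ i h n _ n locr) ?len_i // set_head_id //.
by congr conf; rewrite size_cat /= size_cat /=; lia.
Qed.

Lemma machine_outputs c : wf c -> exists M : tm, exists P : {poly nat},
  forall n, outputs_within M (nseq n true) P.[n] (eval n c).
Proof.
move=> wfc; pose copy := [:: Jump false 4; Push; Move false MoveRight; Goto 0]
                 ++ rewind false 4 ++ rewind true 8.
pose prog := copy ++ code 12 c.
exists (machine prog), ('X * 10%:P + 7%:P + runtime c) => n; rewrite /outputs_within.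
have -> : tm_init (machine prog) (nseq n true) = conf prog n 0 (fun=> 0) 0 [::].
  rewrite /tm_init /conf; congr TMConf; first by apply: val_inj; rewrite /= inordK.
    by apply: funext => k; case: ifP => //; case: ifP.
  by apply: funext => k; case: ifP => //; case: ifP.
have loc_copy : located prog 0 copy by exists [::], (code 12 c).
have loc_code : located prog 12 (code 12 c) by exists copy, [::]; rewrite cats0.
have -> : ('X * 10%:P + 7%:P + runtime c).[n] = (10 * n + 7 + (runtime c).[n])%N.
  by rewrite !hornerD hornerM hornerX !hornerC mulrC.
rewrite (iterD_eq (@run_copy prog n (fun=> 0) loc_copy erefl erefl)
                  (run_cmd n [::] loc_code wfc (fun _ _ => erefl))).
have [E10 E01 E21 E12] := inord1_neq.
split; last by move=> z /=; rewrite E21.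
by apply: val_inj; rewrite /= inordK /prog ?size_cat.
Qed.

(** * Encoding of the witnesses *)

Lemma flatten_nseq_mul (T : Type) m n (s : seq T) :
  flatten (nseq m (flatten (nseq n s))) = flatten (nseq (n * m) s).
Proof. by elim: m => [|m IHm]; rewrite ?muln0 // mulnS nseqD flatten_cat -IHm. Qed.

Lemma flatten_periodic (T : Type) (F : nat -> seq T) d m :
    (forall i, F (d + i)%N = F i) ->
  flatten [seq F i | i <- iota 0 (d * m)] =
    flatten (nseq m (flatten [seq F i | i <- iota 0 d])).
Proof.
move=> F_periodic; elim: m => [|m IHm]; first by rewrite muln0.
rewrite mulnS iotaD map_cat flatten_cat add0n.
suff -> : [seq F i | i <- iota d (d * m)] = [seq F i | i <- iota 0 (d * m)] by rewrite IHm.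
by rewrite -{1}[d]addn0 iotaDl -map_comp; apply: eq_map => i; apply: F_periodic.
Qed.

Lemma flatten_flatten (T : Type) (s : seq (seq (seq T))) :
  flatten (flatten s) = flatten [seq flatten t | t <- s].
Proof. by elim: s => //= t s IHs; rewrite flatten_cat IHs. Qed.

Lemma eval_cat n c d : eval n (Cat c d) = eval n c ++ eval n d.
Proof. by []. Qed.

Lemma eval_rep n i c : eval n (Rep i c) = flatten (nseq n (eval n c)).
Proof. by []. Qed.

Fixpoint times k c := if k is k'.+1 then Cat c (times k' c) else Emit [::].

Lemma eval_times n k c : eval n (times k c) = flatten (nseq k (eval n c)).
Proof. by elim: k => //= k ->. Qed.

(** A loop counts to [n] only; the two further copies needed for [n + 2] are unrolled. *)
Definition rep2 i c := Cat (times 2 c) (Rep i c).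

Lemma eval_rep2 n i c : eval n (rep2 i c) = flatten (nseq (n + 2) (eval n c)).
Proof. by rewrite eval_cat eval_times eval_rep -flatten_cat -nseqD addnC. Qed.

(* side n = 8 * (17 * (n + 2)), and rows and columns have period 8. *)
Definition left_block (j : nat) : seq bool :=
  flatten [seq [:: true; agar (j%:Z - i%:Z - 1)] | i <- iota 0 8].

Definition right_block (j : nat) : seq bool :=
  flatten [seq [:: true; agar (j%:Z + i%:Z)] | i <- iota 0 8].

Definition row_cmd (j : nat) : cmd :=
  Cat (rep2 false (times 17 (Emit (left_block j))))
      (Cat (Rep false (times 2 (Emit [:: false; false])))
           (rep2 false (times 17 (Emit (right_block j))))).

(** Tape 1 counts the rows because the loops inside a row occupy tape 0. *)
Definition rows_cmd : cmd :=
  rep2 true (times 17 (foldr Cat (Emit [::]) [seq row_cmd j | j <- iota 0 8])).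

Definition unary_cmd (k m : nat) : cmd :=
  Cat (Emit (nseq k true)) (Cat (Rep false (Emit (nseq m true))) (Emit [:: false])).

(* 543 + 274 n and 271 + 136 n are 2 side n + 2 n - 1 and side n - 1. *)
Definition witness_cmd : cmd :=
  Cat (Emit (unary 0)) (Cat (unary_cmd 543 274)
    (Cat (Emit (unary 0)) (Cat (unary_cmd 271 136) rows_cmd))).

Lemma eval_unary n k m : eval n (unary_cmd k m) = unary (k + m * n).
Proof.
rewrite /unary_cmd /unary -cats1 nseqD -catA /=; congr (_ ++ (_ ++ _)).
by elim: n => [|n IHn] /=; rewrite ?muln0 // mulnS nseqD IHn.
Qed.

Lemma wf_witness_cmd : wf witness_cmd.
Proof. by []. Qed.

Lemma eval_row n j : eval n (row_cmd j) =
  flatten (nseq (17 * (n + 2)) (left_block j)) ++ nseq (2 * (2 * n)) false ++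
  flatten (nseq (17 * (n + 2)) (right_block j)).
Proof.
rewrite -[LHS]/(eval n (rep2 false (times 17 (Emit (left_block j)))) ++
  flatten (nseq n (nseq 4 false)) ++ eval n (rep2 false (times 17 (Emit (right_block j))))).
rewrite !eval_rep2 !eval_times !flatten_nseq_mul.
congr (_ ++ (_ ++ _)).
by rewrite mulnA mulnC; elim: (n) => // m IHm; rewrite mulSn nseqD -IHm.
Qed.

Lemma cell_code_witness n (i j : nat) : (j < side n)%N ->
  cell_code (witness n) (i%:Z, j%:Z) =
    if (i < side n)%N then [:: true; agar (j%:Z - i%:Z - 1)]
    else if (side n + 2 * n <= i < 2 * side n + 2 * n)%N then
      [:: true; agar (j%:Z + (i - (side n + 2 * n))%N%:Z)]
    else [:: false; false].
Proof.
move=> Hj; rewrite /cell_code fnd_restr mem_domain.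
have sideE : side n = (136 * (n + 2))%N by [].
case: ifP => [Hi|Hi]; case: ifP => [Hi'|Hi'].
- congr [:: _; _]; rewrite /target /= ifT; last by lia.
  (* [side n] is a multiple of 8 and drops out of the argument. *)
  by apply: agar_eqmod; lia.
- rewrite ifT; last by lia.
  by congr [:: _; _]; rewrite /target /= ifF; [congr agar|]; lia.
- by exfalso; lia.
by rewrite ifF //; lia.
Qed.

Lemma row_witness n (j : nat) : (j < side n)%N ->
  flatten [seq cell_code (witness n) (i%:Z, j%:Z) | i <- iota 0 (side n + (2 * n + side n))] =
    eval n (row_cmd j).
Proof.
move=> Hj; rewrite eval_row (iotaD 0 (side n)) (iotaD _ (2 * n)) !map_cat !flatten_cat add0n.
congr (_ ++ (_ ++ _)).
- have -> : [seq cell_code (witness n) (i%:Z, j%:Z) | i <- iota 0 (side n)] =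
            [seq [:: true; agar (j%:Z - i%:Z - 1)] | i <- iota 0 (8 * (17 * (n + 2)))].
    rewrite (_ : (8 * (17 * (n + 2)) = side n)%N); last by rewrite /side; lia.
    by apply/eq_in_map => i; rewrite mem_iota => Hi; rewrite cell_code_witness // ifT.
  by apply: flatten_periodic => i; congr [:: _; _]; apply: agar_eqmod; lia.
- rewrite (_ : [seq _ | i <- iota _ (2 * n)] = nseq (2 * n) [:: false; false]).
    by elim: (2 * n)%N => [|k IHk]; rewrite ?muln0 // mulnS nseqD -IHk.
  apply: (@eq_from_nth _ [::]) => [|k]; rewrite ?size_map ?size_iota ?size_nseq // => Hk.
  rewrite (nth_map 0%N) ?size_iota // nth_iota // nth_nseq Hk cell_code_witness //.
  by rewrite ifF ?ifF //; lia.
have -> : [seq cell_code (witness n) (i%:Z, j%:Z) | i <- iota (side n + 2 * n) (side n)] =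
          [seq [:: true; agar (j%:Z + i%:Z)] | i <- iota 0 (8 * (17 * (n + 2)))].
  rewrite (_ : (8 * (17 * (n + 2)) = side n)%N); last by rewrite /side; lia.
  rewrite -[(side n + 2 * n)%N]addn0 iotaDl -map_comp; apply/eq_in_map => i.
  rewrite mem_iota => Hi; rewrite /= cell_code_witness // ifF; last by lia.
  by rewrite ifT; [congr [:: _; agar _]; lia|lia].
by apply: flatten_periodic => i; congr [:: _; _]; apply: agar_eqmod; lia.
Qed.

Lemma eval_row_periodic n j : eval n (row_cmd (8 + j)) = eval n (row_cmd j).
Proof.
rewrite !eval_row; congr (flatten (nseq _ _) ++ (_ ++ flatten (nseq _ _)));
  by congr flatten; apply: eq_map => i; congr [:: _; _]; apply: agar_eqmod; lia.
Qed.

Lemma eval_rows n : eval n rows_cmd =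
  flatten [seq eval n (row_cmd j) | j <- iota 0 (side n)].
Proof.
rewrite /side (_ : (136 * (n + 2) = 8 * (17 * (n + 2)))%N); last by lia.
rewrite flatten_periodic; last by move=> j; apply: eval_row_periodic.
rewrite eval_rep2 eval_times flatten_nseq_mul; congr (flatten (nseq _ _)).
Qed.

Lemma encodes_witness n : encodes (eval n witness_cmd) (witness n).
Proof.
(* The box starts at the origin; [zint 0 b] has [b + 1] elements, hence the predecessors. *)
exists 0%N, (2 * side n + 2 * n).-1, 0%N, (side n).-1; split.
  case=> i j; rewrite mem_domain !mem_zint /= /side; lia.
rewrite -[LHS]/(unary 0 ++ eval n (unary_cmd 543 274) ++ unary 0 ++
  eval n (unary_cmd 271 136) ++ eval n rows_cmd) !eval_unary.
congr (_ ++ (unary _ ++ (_ ++ (unary _ ++ _)))); try by rewrite /side; lia.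
rewrite eval_rows /zint !add0n !prednK; [|rewrite /side; lia|rewrite /side; lia].
rewrite flatten_flatten -!map_comp; congr flatten.
apply/eq_in_map => j; rewrite mem_iota add0n => /row_witness <- /=.
rewrite subr0 (_ : (2 * side n + 2 * n = side n + (2 * n + side n))%N); last by lia.
by rewrite -map_comp; congr flatten; apply: eq_map => i /=; rewrite subr0.
Qed.

Theorem theorem2 :
  exists (M : tm) (P : {poly nat}), forall n : nat,
    exists (w : seq bool) (p : pattern),
      [/\ outputs_within M (nseq n true) P.[n] w,
          encodes w p,
          life_preim n p !=set0 &
          life_preim n.+1 p = set0].
Proof.
have [M [P M_out]] := machine_outputs wf_witness_cmd.
exists M, P => n; exists (eval n witness_cmd), (witness n); split.
- exact: M_out.
- exact: encodes_witness.
- exact: witness_preim.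
exact: witness_no_preim.
Qed.
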